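(* Let $p$ be an odd prime, let $G$ be a quasi-powerful $p$-group and let $x,y\in G$. Then $o([x,y])\le o(y)$.
   Context: For an odd prime $p$, a finite $p$-group $G$ is powerful if $[G,G]\le G^{p}$, and $G$ is quasi-powerful if $G/Z(G)$ is powerful. $o(g)$ denotes the order of $g$; $[x,y]=x^{-1}y^{-1}xy$. *)

(* Defs.v *)
From mathcomp Require Import all_boot all_fingroup all_solvable.
Set Implicit Arguments. Unset Strict Implicit. Unset Printing Implicit Defensive.
Local Open Scope group_scope.

Definition pow_subgroup (p : nat) (gT : finGroupType) (G : {set gT}) : {set gT} :=
  <<[set x ^+ p | x in G]>>.

Definition powerful (p : nat) (gT : finGroupType) (G : {set gT}) : bool :=
  [~: G, G] \subset pow_subgroup p G.

Definition quasi_powerful (p : nat) (gT : finGroupType) (G : {group gT}) : bool :=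
  powerful p (G / 'Z(G)).

(* Main.v *)
Require Import Defs.
From mathcomp Require Import all_boot all_fingroup all_solvable.
Set Implicit Arguments.
Unset Strict Implicit.
Unset Printing Implicit Defensive.
Local Open Scope group_scope.

(** Let Z be central in G with G / Z powerful, and let N_k be the preimage in G
    of the k-fold iterate of K |-> K^p on G / Z, so that [N_k, G] <= N_(k+1) and
    every element of N_(k+1) is, modulo Z, the p-th power of an element of N_k.
    By induction on #|G| one shows that [(a b)^(p^i) = a^(p^i) b^(p^i)] as soon
    as both p^i-th powers lie in Z; the theorem is the case a = y^-1, b = y ^ x.
    For nonabelian G the induction hypothesis applies to every <y> N_1, which
    bounds the order of commutators [y, x] and makes the elements of N_1 killed
    by p^m a normal subgroup E_m.  Following Fernandez-Alcober, one shows that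
    [a, y]^(p^k) = 1 when a \in N_j, a^(p^(k+1)) \in Z and y^(p^(j+k)) \in Z,
    by descending induction on j + k and ascending induction on j: commutators
    of elements deep in the filtration gain a factor p.  It follows that
    <a, b> has class at most 2 modulo E_(i-1), so that
    (a b)^p = a^p b^p t with t \in E_(i-1), and one concludes inside N_1. *)

(** * Powers and commutators modulo a normalised subgroup *)

(** Modulo [E], [[~ b, a]] commutes with [a] and [b], so the defect of the power law is [[~ b, a]]
    to the exponent ['C(p, 2)], a multiple of [p] because [p] is odd. *)
Lemma expMg_class2 (p : nat) (gT : finGroupType) (E : {group gT}) (a b : gT) :
  odd p -> a \in 'N(E) -> b \in 'N(E) ->
  [~ b, a, a] \in E -> [~ b, a, b] \in E -> [~ b, a] ^+ p \in E ->
  (a ^+ p * b ^+ p)^-1 * (a * b) ^+ p \in E.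
Proof.
move=> odd_p nEa nEb cEa cEb cEp.
have nEc: [~ b, a] \in 'N(E) by rewrite groupR.
have com c: c \in 'N(E) -> [~ b, a, c] \in E ->
    commute (coset E c) [~ coset E b, coset E a].
  move=> nEc' Ec; rewrite -morphR //; apply/esym/commgP.
  by rewrite -morphR // -(coset_id Ec).
have coE1 u: u \in 'N(E) -> coset E u = 1 -> u \in E.
  by move=> nEu /(coset_idr nEu).
have zp: [~ coset E b, coset E a] ^+ p = 1.
  by rewrite -morphR // -morphX //; apply: coset_id.
apply: coE1; first by rewrite !(groupM, groupX, groupV).
rewrite morphM ?(groupM, groupX, groupV) // morphV ?(groupM, groupX) //.
rewrite morphX ?groupM // !morphM ?groupX // !morphX //.
rewrite (expMg_Rmul p (com b nEb cEb) (com a nEa cEa)) bin2odd // expgM zp.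
by rewrite expg1n mulg1 mulVg.
Qed.

Lemma mem_Mho1 (p : nat) (gT : finGroupType) (G : {group gT}) (x : gT) :
  p.-group G -> x \in G -> x ^+ p \in 'Mho^1(G).
Proof.
by move=> pG Gx; rewrite -{1}(expn1 p) Mho_p_elt // (mem_p_elt pG Gx).
Qed.

Lemma Mho1E (p : nat) (gT : finGroupType) (G : {group gT}) :
  p.-group G -> 'Mho^1(G) = <<[set x ^+ p | x in G]>>.
Proof. by move=> pG; rewrite (MhoE 1 pG) expn1. Qed.

(** In the nilpotent group [K / M], a subgroup contained in its own commutator with the whole group
    is trivial. Hence an inclusion in [M] may be checked modulo [[~: Q, K]] as well. *)
Lemma nilpotent_commg_sub (gT : finGroupType) (K Q M : {group gT}) :
  nilpotent K -> Q \subset K -> M <| K ->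
  Q \subset M <*> [~: Q, K] -> Q \subset M.
Proof.
move=> nilK sQK /andP[sMK nMK] sR.
have nMQ := subset_trans sQK nMK.
have nMR: [~: Q, K] \subset 'N(M).
  apply: subset_trans nMK.
  by rewrite (subset_trans (commSg K sQK)) // der1_subG.
rewrite -quotient_sub1 //.
have /forall_inP nilKM := quotient_nil M nilK.
rewrite (eqP (nilKM (Q / M)%G _)) //= subsetI quotientS //= -quotientR //.
by rewrite -(quotientYidl nMR) quotientS.
Qed.

(** With [Q] the commutator to be bounded, [nilpotent_commg_sub] allows [[~: Q, K]] to be factored
    out. The claim then reduces to the generators [n ^+ p], where the class 2 formula applies to [n
    ^ g = n * [~ n, g]]. *)
Lemma Mho1_commg (p : nat) (gT : finGroupType) (K N : {group gT}) :
  odd p -> p.-group K -> N <| K -> [~: N, K] \subset 'Mho^1(N) ->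
  [~: 'Mho^1(N), K] \subset 'Mho^1('Mho^1(N)).
Proof.
move=> odd_p pK nsNK sNK; have [sNN nNK] := andP nsNK.
have pN := pgroupS sNN pK; have pN1 := pgroupS (Mho_sub 1 N) pN.
have nsPK: 'Mho^1(N) <| K by apply: char_normal_trans (Mho_char 1 N) nsNK.
have nsMK: 'Mho^1('Mho^1(N)) <| K.
  by apply: char_normal_trans (Mho_char 1 _) nsPK.
have sQP: [~: 'Mho^1(N), K] \subset 'Mho^1(N).
  by rewrite commg_subl; case/andP: nsPK.
have sQK := subset_trans sQP (normal_sub nsPK).
apply: (@nilpotent_commg_sub _ K [~: 'Mho^1(N), K] _ (pgroup_nil pK)) => //.
pose R := ('Mho^1('Mho^1(N)) <*> [~: 'Mho^1(N), K, K])%G.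
rewrite -[_ <*> _]/(gval R).
have sMR: 'Mho^1('Mho^1(N)) \subset R := joing_subl _ _.
have sQR: [~: 'Mho^1(N), K, K] \subset R := joing_subr _ _.
have nsRK: R <| K.
  apply: normalY => //; rewrite /normal commg_normr andbT.
  by rewrite (subset_trans (commSg K sQK)) // der1_subG.
have nRK := normal_norm nsRK.
rewrite -quotient_cents2 ?(subset_trans (normal_sub nsPK)) //.
have nRp: [set n ^+ p | n in N] \subset 'N(R).
  apply/subsetP=> _ /imsetP[n Nn ->].
  by rewrite (subsetP nRK) // groupX // (subsetP sNN).
rewrite (Mho1E pN) quotient_gen // gen_subG quotient_cents2 //.
rewrite gen_subG; apply/subsetP=> _ /imset2P[_ g /imsetP[n Nn ->] Kg ->].
have Kn := subsetP sNN n Nn.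
have Pc: [~ n, g] \in 'Mho^1(N) by apply: (subsetP sNK); rewrite mem_commg.
have Kc := subsetP (normal_sub nsPK) _ Pc.
have Qcn: [~ n, g, n] \in [~: 'Mho^1(N), K] by rewrite mem_commg.
have: (n ^+ p * [~ n, g] ^+ p)^-1 * (n * [~ n, g]) ^+ p \in R.
  apply: expMg_class2; rewrite ?(subsetP nRK) //.
  - by rewrite (subsetP sQR) ?mem_commg.
  - by rewrite (subsetP sQR) ?mem_commg.
  - by rewrite (subsetP sMR) // (mem_Mho1 pN1) // (subsetP sQP).
rewrite -conjg_mulR -conjXg invMg -mulgA -commgEl groupMl // groupV.
by rewrite (subsetP sMR) // (mem_Mho1 pN1).
Qed.

(** * Powerful p-groups *)

(** Modulo [[~: N, K]] the subgroup [N] is central, so adjoining the single element [x] to it gives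
    an abelian group. *)
Lemma der_cycle_join (gT : finGroupType) (K N : {group gT}) (x : gT) :
  N <| K -> x \in K -> [~: <[x]> <*> N, <[x]> <*> N] \subset [~: N, K].
Proof.
move=> nsNK Kx; have [sNK nNK] := andP nsNK.
have sHK: <[x]> <*> N \subset K by rewrite join_subG cycle_subG Kx.
have nRK: K \subset 'N([~: N, K]) by apply: commg_normr.
have nRH := subset_trans sHK nRK.
have nRx: <[x]> \subset 'N([~: N, K]) by rewrite cycle_subG (subsetP nRK).
have nRN := subset_trans sNK nRK.
have cNK: N / [~: N, K] \subset 'C(K / [~: N, K]) by apply: quotient_cents2r.
rewrite -quotient_cents2 //= -[_ \subset _]/(abelian _) quotientY // abelianY.
rewrite quotient_abelian ?cycle_abelian //=.
rewrite /abelian (subset_trans cNK) ?centS ?quotientS //=.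
by rewrite (subset_trans cNK) ?centS ?quotientS // cycle_subG.
Qed.

(** Here the Frattini subgroup is contained in ['Mho^1(K)], whose elements are thus
    non-generators. *)
Lemma powerful_cyclic (p : nat) (gT : finGroupType) (K : {group gT}) (x : gT) :
  p.-group K -> [~: K, K] \subset 'Mho^1(K) -> x \in K ->
  <[x]> <*> 'Mho^1(K) = K -> cyclic K.
Proof.
move=> pK powK Kx defK; rewrite -(@Phi_nongen _ K [set x]) ?cycle_cyclic //.
apply/eqP; rewrite eqEsubset join_subG Phi_sub sub1set Kx /=.
rewrite -{1}defK join_subG cycle_subG (subsetP (joing_subr _ _)) ?set11 //=.
by rewrite (subset_trans _ (joing_subl _ _)) // (Phi_joing pK) joing_subr.
Qed.

(** Induction on the order: [u] is a p-th power up to [M], and this error is absorbed by passing to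
    the subgroup [H] generated by the root [x] and [N]. *)
Lemma powerful_Mho1 (p : nat) (gT : finGroupType) (K : {group gT}) :
  odd p -> p.-group K -> [~: K, K] \subset 'Mho^1(K) ->
  forall u, u \in 'Mho^1(K) -> exists2 x, x \in K & u = x ^+ p.
Proof.
move=> odd_p; elim: {K}_.+1 {-2}K (ltnSn #|K|) => // m IHm K leKm pK powK u Pu.
pose N := ('Mho^1(K))%G; pose M := ('Mho^1(N))%G.
have nsNK: N <| K := Mho_normal 1 K.
have [sNK nNK] := andP nsNK; have pN := pgroupS sNK pK.
have nsMK: M <| K := char_normal_trans (Mho_char 1 N) nsNK.
have [sMK nMK] := andP nsMK.
have sNKM: [~: N, K] \subset M := Mho1_commg odd_p pK (normal_refl K) powK.
have [x Kx Mxu]: exists2 x, x \in K & (x ^+ p)^-1 * u \in M.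
  (* [N] is central modulo [M], so a product of p-th powers is a p-th power up to [M]. *)
  have gS: group_set ([set x ^+ p | x in K] * M).
    apply/group_setP; split=> [|_ w /mulsgP[_ m1 /imsetP[a Ka ->] Mm1 ->]].
      rewrite -[1]mulg1 mem_mulg //; apply/imsetP.
      by exists 1; rewrite ?expg1n.
    case/mulsgP=> _ m2 /imsetP[b Kb ->] Mm2 -> {w}.
    apply/mulsgP; exists ((a * b) ^+ p)
      ((a * b) ^- p * (a ^+ p * b ^+ p) * (m1 ^ (b ^+ p) * m2)).
    - by apply/imsetP; exists (a * b); rewrite ?groupM.
    - rewrite groupM //; last first.
        by rewrite groupM // memJ_norm // (subsetP nMK) ?groupX.
      rewrite -groupV invMg invgK.
      have Nba: [~ b, a] \in N by rewrite (subsetP powK) ?mem_commg.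
      apply: expMg_class2; rewrite ?(subsetP nMK) // ?(mem_Mho1 pN) //;
        by rewrite (subsetP sNKM) ?mem_commg.
    - by rewrite -!mulgA !mulKVg.
  have: u \in Group gS.
    apply: subsetP u Pu; rewrite (Mho1E pK) gen_subG.
    by apply/subsetP=> v Sv; rewrite -[v]mulg1; apply: mem_mulg.
  by case/mulsgP=> _ m1 /imsetP[x Kx ->] Mm1 ->; exists x; rewrite ?mulKg.
pose H := (<[x]> <*> N)%G.
have sNH: N \subset H := joing_subr _ _.
have Hx: x \in H by rewrite (subsetP (joing_subl _ _)) ?cycle_id.
have sHK: H \subset K by rewrite join_subG cycle_subG Kx.
have pH := pgroupS sHK pK.
have Hu: u \in 'Mho^1(H).
  rewrite -(mulKVg (x ^+ p) u) groupM ?(mem_Mho1 pH) //.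
  by apply: subsetP Mxu; apply: MhoS.
(* A proper [H] is again powerful, since its derived subgroup lies in [M]; otherwise [H = K] is
   cyclic. *)
have [ltHK | leKH] := ltnP #|H| #|K|.
  have powH: [~: H, H] \subset 'Mho^1(H).
    apply: (@subset_trans _ _ M); last exact: MhoS.
    exact: subset_trans (der_cycle_join nsNK Kx) sNKM.
  have [y Hy ->] := IHm H (leq_trans ltHK leKm) pH powH u Hu.
  by exists y; rewrite ?(subsetP sHK).
have abK: abelian K.
  apply/cyclic_abelian/(powerful_cyclic pK powK Kx)/eqP.
  by rewrite eqEcard sHK.
move: Pu; rewrite (MhoEabelian 1 pK abK) expn1.
by case/imsetP=> y Ky ->; exists y.
Qed.

(** * The power filtration and the power law modulo a central subgroup *)

(** [Mho1_commg] and [powerful_Mho1], iterated on [G / Z], are pulled back to [G]. The last clause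
    serves to show that each [<[y]> <*> N 1] is powerful modulo [Z]. *)
Lemma central_filtration (p : nat) (gT : finGroupType) (Z G : {group gT}) :
  odd p -> p.-group G -> Z \subset 'Z(G) ->
  [~: G / Z, G / Z] \subset 'Mho^1(G / Z) ->
  exists N : nat -> {group gT},
    [/\ N 0%N = G,
        (forall k, Z \subset N k) /\ (forall k, N k.+1 \subset N k),
        (forall k, [~: N k, G] \subset N k.+1),
        (forall k v, v \in N k -> v ^+ p \in N k.+1) /\
        (forall k u, u \in N k.+1 -> exists2 v, v \in N k & v ^- p * u \in Z)
      & (forall k, N k.+1 / Z \subset 'Mho^1(N k / Z))].
Proof.
move=> odd_p pG sZ powG.
have nsZG: Z <| G by apply: sub_center_normal.
have nZG := normal_norm nsZG; have pGZ := quotient_pgroup Z pG.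
pose M k := iter k (fun L : {group coset_of Z} => 'Mho^1(L)%G) (G / Z)%G.
have nsM k: M k <| G / Z.
  elim: k => [|k IHk] /=; first exact: normal_refl.
  exact: char_normal_trans (Mho_char 1 _) IHk.
have pM k: p.-group (M k) := pgroupS (normal_sub (nsM k)) pGZ.
have sMG k: [~: M k, G / Z] \subset M k.+1.
  by elim: k => [|k IHk] //=; apply: Mho1_commg odd_p pGZ (nsM k) IHk.
have powM k u: u \in M k.+1 -> exists2 v, v \in M k & u = v ^+ p.
  apply: powerful_Mho1 odd_p (pM k) _ u.
  by apply: subset_trans (sMG k); rewrite commgS ?normal_sub.
have nN k: coset Z @*^-1 M k \subset 'N(Z) by apply: subsetIl.
exists (fun k => (coset Z @*^-1 M k)%G); split=> [||k||k].
- by apply/val_inj; rewrite /= quotientGK.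
- by split=> k; rewrite ?sub_cosetpre //= cosetpreSK Mho_sub.
- rewrite /= -sub_quotient_pre ?comm_subG //.
  by rewrite quotientR // cosetpreK sMG.
- split=> [k v Nv | k u Nu].
    have nZv := subsetP (nN k) v Nv.
    apply: mem_morphpre; first by rewrite groupX.
    rewrite morphX //= mem_Mho1 //.
    by rewrite -(cosetpreK (M k)) mem_quotient.
  have nZu := subsetP (nN k.+1) u Nu.
  have /powM[w Mw def_u]: coset Z u \in M k.+1.
    by rewrite -(cosetpreK (M k.+1)) mem_quotient.
  have [v nZv def_w] := cosetP w; rewrite def_w in Mw def_u.
  exists v; first exact: mem_morphpre.
  apply: coset_idr; first by rewrite groupM ?groupV ?groupX.
  by rewrite morphM ?morphV ?morphX ?groupV ?groupX //= def_u mulVg.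
by rewrite /= !cosetpreK.
Qed.

Lemma commg_expg_eq1 (gT : finGroupType) (x y : gT) (n : nat) :
  (y^-1 * y ^ x) ^+ n = y ^- n * (y ^ x) ^+ n ->
  commute (y ^+ n) x -> [~ y, x] ^+ n = 1.
Proof.
by move=> yM cyx; rewrite commgEl yM -conjXg conjgE cyx mulKg mulVg.
Qed.

(** [Z] is any central subgroup, not the whole centre, so that it stays fixed when the induction
    replaces [G] by a subgroup with a possibly different centre. *)
Lemma expMg_mod_center (p : nat) (gT : finGroupType) (Z G : {group gT}) :
  odd p -> p.-group G -> Z \subset 'Z(G) ->
  [~: G / Z, G / Z] \subset 'Mho^1(G / Z) ->
  forall i, {in G &, forall a b, a ^+ (p ^ i) \in Z -> b ^+ (p ^ i) \in Z ->
    (a * b) ^+ (p ^ i) = a ^+ (p ^ i) * b ^+ (p ^ i)}.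
Proof.
move=> odd_p; have [m] := ubnP #|G|; elim: m G => // m IHm G leGm pG sZ powG.
have [abG i a b Ga Gb _ _ | nabG] := boolP (abelian G).
  by rewrite expgMn //; apply: (centsP abG).
have [sZG cZG] : Z \subset G /\ G \subset 'C(Z).
  by move: sZ; rewrite subsetI centsC => /andP[].
have [N [N0 [sZN sNN] sNG [expN powN] quoN]] :=
  central_filtration odd_p pG sZ powG.
have nsZG: Z <| G by apply: sub_center_normal.
have nZG := normal_norm nsZG.
have sNG0 k: N k \subset G.
  by elim: k => [|k IHk]; rewrite ?N0 // (subset_trans (sNN k)).
have sN1 k: N k.+1 \subset N 1%N.
  by elim: k => // k IHk; apply: subset_trans (sNN _) IHk.
have nNG k: G \subset 'N(N k).
  by rewrite -commg_subl (subset_trans (sNG k)).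
have cZ z g: z \in Z -> g \in G -> commute z g.
  by move=> Zz Gg; apply/esym/(centsP cZG).
have congZ n u v: v \in G -> v^-1 * u \in Z -> v ^- n * u ^+ n \in Z.
  move=> Gv Zvu; rewrite -[u](mulKVg v) expgMn ?mulKg ?groupX //.
  exact/commute_sym/cZ.
have memZ u v: v^-1 * u \in Z -> (u \in Z) = (v \in Z).
  by move=> Zvu; rewrite -[u](mulKVg v) groupMr.
have IH y: y \in G -> forall i, {in <[y]> <*> N 1%N &, forall a b,
    a ^+ (p ^ i) \in Z -> b ^+ (p ^ i) \in Z ->
    (a * b) ^+ (p ^ i) = a ^+ (p ^ i) * b ^+ (p ^ i)}.
  move=> Gy; pose H := (<[y]> <*> N 1%N)%G.
  have sHG: H \subset G by rewrite join_subG cycle_subG Gy sNG0.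
  have sNH: N 1%N \subset H := joing_subr _ _.
  have sZH := subset_trans (sZN 1%N) sNH.
  apply: (IHm H); last 1 first.
  - rewrite -quotientR ?(subset_trans sHG) //.
    have sHN2: [~: H, H] \subset N 2%N.
      apply: subset_trans (sNG 1%N); apply: der_cycle_join => //.
      by rewrite /normal sNG0 nNG.
    apply: subset_trans (quotientS Z sHN2) _.
    by apply: subset_trans (quoN 1%N) (MhoS 1 (quotientS Z sNH)).
  - apply: leq_trans (proper_card _) leGm.
    (* If [H = G], then [G / Z] is generated by the image of [y] modulo its Frattini subgroup, so it
       is cyclic and [G] is abelian. *)
    rewrite properEneq sHG andbT; apply: contra nabG => /eqP defG.
    apply: cyclic_factor_abelian sZ _.
    apply: (powerful_cyclic (quotient_pgroup Z pG) powG (mem_quotient Z Gy)).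
    have nZy: y \in 'N(Z) by rewrite (subsetP nZG).
    apply/eqP; rewrite eqEsubset join_subG Mho_sub cycle_subG mem_quotient //=.
    rewrite -{1}defG quotientY ?cycle_subG ?(subset_trans (sNG0 1%N)) //.
    rewrite quotient_cycle // join_subG joing_subl.
    by have:= quoN 0%N; rewrite N0 => /subset_trans-> //; apply: joing_subr.
  - exact: pgroupS pG.
  by rewrite subsetI sZH centsC (subset_trans sHG).
(* Although [x] need not lie in [H], the conjugate [y ^ x = y * [~ y, x]] does, so [IH] covers the
   product of [y^-1] and [y ^ x]. *)
have comml i x y: x \in G -> y \in G ->
    y ^+ (p ^ i) \in Z -> [~ y, x] ^+ (p ^ i) = 1.
  move=> Gx Gy Zy; pose H := (<[y]> <*> N 1%N)%G.
  have Hy: y \in H by rewrite (subsetP (joing_subl _ _)) ?cycle_id.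
  have Hyx: [~ y, x] \in H.
    apply: (subsetP (joing_subr _ _)); apply: (subsetP (sNG 0%N)).
    by rewrite mem_commg ?N0.
  apply: commg_expg_eq1 => //; last exact: cZ.
  rewrite (IH y Gy) ?expgVn ?groupV //.
    by rewrite conjg_mulR groupM.
  by rewrite -conjXg conjgE (cZ _ _ Zy Gx) mulKg.
have commr i x y: x \in G -> y \in G ->
    y ^+ (p ^ i) \in Z -> [~ x, y] ^+ (p ^ i) = 1.
  by move=> Gx Gy Zy; rewrite -invg_comm expgVn comml ?invg1.
have IH1 i: {in N 1%N &, forall a b, a ^+ (p ^ i) \in Z -> b ^+ (p ^ i) \in Z ->
    (a * b) ^+ (p ^ i) = a ^+ (p ^ i) * b ^+ (p ^ i)}.
  by move=> a b Na Nb; apply: (IH 1) => //; rewrite (subsetP (joing_subr _ _)).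
have torsN k: exists2 E : {group gT}, G \subset 'N(E) &
    forall h, (h \in E) = (h \in N 1%N) && (h ^+ (p ^ k) == 1).
  have gE: group_set [set h in N 1%N | h ^+ (p ^ k) == 1].
    apply/group_setP; split=> [|a b]; rewrite !inE ?group1 ?expg1n ?eqxx //.
    move=> /andP[Na /eqP a1] /andP[Nb /eqP b1].
    by rewrite groupM //= IH1 ?a1 ?b1 ?mulg1.
  exists (Group gE) => [|h]; last by rewrite inE.
  apply/normsP=> g Gg; apply/setP=> h; rewrite mem_conjg !inE.
  by rewrite -conjXg memJ_norm ?(subsetP (nNG 1%N)) ?groupV // conjg_eq1.
have Zle k n x: k <= n -> x ^+ (p ^ k) \in Z -> x ^+ (p ^ n) \in Z.
  by move=> le_kn Zx; rewrite -(subnKC le_kn) expnD expgM groupX.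
have rootN j a: a \in N j -> exists2 v, v \in G & v ^- (p ^ j) * a \in Z.
  elim: j a => [|j IHj] a Na; first by exists a; rewrite -?N0 ?expg1 ?mulVg.
  have [u Nu Zua] := powN j a Na; have [v Gv Zvu] := IHj u Nu.
  exists v; rewrite // -[a](mulKVg (u ^+ p)) mulgA groupM // expnSr expgM.
  by rewrite congZ ?groupX.
(* From [a] alone, [comml] gives only the exponent [p ^ k.+1]; the depth [j] of [a] and the
   condition on [y] together save a factor [p]. *)
have gain i j k a y: (j + k)%N = i -> a \in N j -> y \in G ->
    a ^+ (p ^ k.+1) \in Z -> y ^+ (p ^ i) \in Z -> [~ a, y] ^+ (p ^ k) = 1.
  have [e cardG] := p_natP pG.
  have expG1 x n: e <= n -> x \in G -> x ^+ (p ^ n) = 1.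
    move=> le_en Gx; apply/eqP; rewrite -order_dvdn.
    by rewrite (dvdn_trans (order_dvdG Gx)) // cardG dvdn_exp2l.
  (* The descent starts at i = 2e: then either p^e kills [a, y] or a \in Z. *)
  move: j k a y; have [d] := ubnP (e.*2 - i); elim: d i => // d IHd i leid j.
  have [le_ei k a y def_i Na Gy _ _ | lt_ie] := leqP e.*2 i.
    have Ga := subsetP (sNG0 j) a Na.
    have [le_ek | lt_ke] := leqP e k; first by rewrite expG1 ?groupR.
    have le_ej: e <= j.
      rewrite -(leq_add2r e) addnn (leq_trans le_ei) // -def_i leq_add2l.
      exact: ltnW.
    have [v Gv Zva] := rootN j a Na.
    have Za: a \in Z by rewrite (memZ _ _ Zva) expG1.
    by have /commgP/eqP-> := cZ a y Za Gy; rewrite expg1n.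
  elim: j => [|j IHj] k a y def_i Na Gy Za Zy.
    have Ga := subsetP (sNG0 0%N) a Na.
    by rewrite commr // -[k]add0n def_i.
  have [g Ng Zga] := powN j a Na; have Gg := subsetP (sNG0 j) g Ng.
  have Zg: g ^+ (p ^ k.+2) \in Z.
    by rewrite expnS expgM -(memZ _ _ (congZ _ _ _ (groupX p Gg) Zga)).
  have -> : [~ a, y] = [~ g ^+ p, y].
    rewrite -[a](mulKVg (g ^+ p)) commMgR.
    have /commgP/eqP-> := cZ _ y Zga Gy.
    have Gpy: [~ g ^+ p, y] \in G by rewrite groupR ?groupX.
    have /commute_sym/commgP/eqP-> := cZ _ _ Zga Gpy.
    by rewrite !mulg1.
  have Nd: [~ g, y] \in N j.+1 by rewrite (subsetP (sNG j)) ?mem_commg.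
  have Gd: [~ g, y] \in G by rewrite groupR.
  (* Passing from [a] to its root [g] trades [j.+1] and [k] for [j] and [k.+1]: the sum is still
     [i], so the inner induction applies. *)
  have d1: [~ g, y] ^+ (p ^ k.+1) = 1 by rewrite IHj // addnS.
  have Nv: [~ g, y, g] \in N j.+2 by rewrite (subsetP (sNG j.+1)) ?mem_commg.
  have v1: [~ g, y, g] ^+ (p ^ k.+1) = 1 by rewrite comml ?d1.
  have [E nEG memE] := torsN k.
  have lt_d: e.*2 - i.+1 < d by rewrite subnS prednK ?subn_gt0.
  (* [[~ g, y, g]] lies in [N j.+2], and [j.+2 + k = i.+1]: this is where the outer descent is
     used. *)
  have Ev w: w \in G -> w ^+ (p ^ i.+1) \in Z -> [~ g, y, g, w] \in E.
    move=> Gw Zw; rewrite memE (subsetP (sN1 j.+2)); last first.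
      by rewrite (subsetP (sNG j.+2)) ?mem_commg.
    by rewrite (IHd i.+1 lt_d j.+2 k) ?v1 ?eqxx // -def_i.
  have: (g ^+ p * [~ g, y] ^+ p)^-1 * (g * [~ g, y]) ^+ p \in E.
    apply: expMg_class2; rewrite ?(subsetP nEG) ?Ev //.
    - by apply: Zle Zg; rewrite -def_i addSn !ltnS leq_addl.
    - apply: (Zle k.+1); rewrite ?d1 // -def_i.
      by rewrite addSn !ltnS ltnW // ltnS leq_addl.
    rewrite memE groupX ?(subsetP (sN1 j.+1)) //=.
    by rewrite -expgM -expnS v1.
  (* Since [g * [~ g, y] = g ^ y], the element in [E] equals [[~ g, y] ^- p * [~ g ^+ p, y]]; its
     first factor is in [E] by [d1]. *)
  rewrite -conjg_mulR -conjXg invMg -mulgA -commgEl groupMl ?memE.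
    by case/andP=> _ /eqP.
  by rewrite groupV groupX ?(subsetP (sN1 j)) //= expgVn -expgM -expnS d1 invg1.
case=> [|i] a b Ga Gb Za Zb; first by rewrite expn0 !expg1.
have [E nEG memE] := torsN i.
have Nc: [~ b, a] \in N 1%N by rewrite (subsetP (sNG 0%N)) ?mem_commg ?N0.
have c1: [~ b, a] ^+ (p ^ i.+1) = 1 by rewrite comml.
(* [gain] at [j = 1] and [k = i], as [[~ b, a]] lies in [N 1]. *)
have Ec w: w \in G -> w ^+ (p ^ i.+1) \in Z -> [~ b, a, w] \in E.
  move=> Gw Zw; rewrite memE (gain i.+1 1%N i) ?c1 ?eqxx ?andbT //.
  by rewrite (subsetP (sN1 1%N)) // (subsetP (sNG 1%N)) ?mem_commg.
have Et: (a ^+ p * b ^+ p)^-1 * (a * b) ^+ p \in E.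
  apply: expMg_class2; rewrite ?(subsetP nEG) ?Ec // memE groupX //=.
  by rewrite -expgM -expnS c1.
have Np x: x \in G -> x ^+ p \in N 1%N by rewrite -N0; apply: expN.
(* After one p-th power all factors, including the error [t], lie in [N 1], where [IH1] splits the
   remaining [p ^ i]-th power and [t] disappears. *)
rewrite !expnS !(expgM _ p).
rewrite -(mulKVg (a ^+ p * b ^+ p) ((a * b) ^+ p)).
move: (_ * (a * b) ^+ p) Et => t Et.
have [Nt /eqP t1] : t \in N 1%N /\ t ^+ (p ^ i) == 1.
  by apply/andP; rewrite -memE.
have Zbp: (b ^+ p) ^+ (p ^ i) \in Z by rewrite -expgM -expnS.
have bt: (b ^+ p * t) ^+ (p ^ i) = (b ^+ p) ^+ (p ^ i).
  by rewrite IH1 ?Np ?t1 ?mulg1.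
rewrite -mulgA IH1 ?bt ?groupM ?Np //.
by rewrite -expgM -expnS.
Qed.

Theorem theorem3 (p : nat) (gT : finGroupType) (G : {group gT}) (x y : gT) :
  prime p -> odd p -> p.-group G -> quasi_powerful p G ->
  x \in G -> y \in G ->
  #[ [~ x, y] ] <= #[y].
Proof.
move=> _ odd_p pG qpG Gx Gy.
have powG: [~: G / 'Z(G), G / 'Z(G)] \subset 'Mho^1(G / 'Z(G)).
  by rewrite (Mho1E (quotient_pgroup 'Z(G) pG)).
have [i oy] := p_natP (mem_p_elt pG Gy).
have yi: y ^+ (p ^ i) = 1 by rewrite -oy expg_order.
have yxi: (y ^ x) ^+ (p ^ i) = 1 by rewrite -conjXg yi conj1g.
have cyx: [~ y, x] ^+ (p ^ i) = 1.
  apply: commg_expg_eq1; last by rewrite yi; apply/commute_sym/commute1.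
  rewrite -expgVn; apply: (expMg_mod_center odd_p pG (subxx _) powG).
  - by rewrite groupV.
  - by rewrite groupJ.
  - by rewrite expgVn yi invg1.
  - by rewrite yxi.
by rewrite -invg_comm orderV dvdn_leq // order_dvdn oy cyx.
Qed.
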